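(* Let $G$ be a finite nilpotent group. Then $\Gamma(G)$ is triangle-free if and only if either $G$ is a cyclic $p$-group for some prime $p$, or $G\cong C_{p^a q^b}$ for some distinct primes $p,q$ and integers $a,b\ge 1$.
   Context: For a finite group $G$, the co-maximal subgroup graph $\Gamma(G)$ is the simple undirected graph whose vertices are the non-trivial proper subgroups of $G$, two distinct vertices $H,K$ being adjacent if and only if $HK=G$, where $HK=\{hk: h\in H, k\in K\}$. A graph is triangle-free if it contains no cycle of length $3$. $C_n$ denotes the cyclic group of order $n$. *)

(* Defs.v *)
From HB Require Import structures.
From mathcomp Require Import all_boot all_order all_algebra all_fingroup all_solvable.

Set Implicit Arguments.
Unset Strict Implicit.
Unset Printing Implicit Defensive.

Import GroupScope.

(* [ucycle e c] requires the vertices of [c] to be pairwise distinct, so that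
   the sequences [c] below are the graph-theoretic cycles of length 3. *)
Definition triangle_free (V : finType) (e : rel V) : Prop :=
  forall c : seq V, ucycle e c -> size c <> 3.

Section CoMaximalSubgroupGraph.

Variables (gT : finGroupType) (G : {group gT}).

Definition comax_vertex : finType :=
  {H : {group gT} | (H :!=: 1) && (H \proper G)}.

(* The product is the set [{h * k | h \in H, k \in K}], not the subgroup
   generated by [H] and [K]. *)
Definition comax_adj : rel comax_vertex :=
  fun H K => (H != K) && (val H * val K == G :> {set gT}).

Lemma comax_adj_irr : irreflexive comax_adj.
Proof. by move=> H; rewrite /comax_adj eqxx. Qed.

Lemma comax_adj_sym : symmetric comax_adj.
Proof.
suff sub H K : comax_adj H K -> comax_adj K H by move=> H K; apply/idP/idP; apply: sub.
rewrite /comax_adj eq_sym => /andP[-> /eqP defG] /=.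
have /comm_group_setP <- : group_set (val H * val K) by rewrite defG groupP.
exact/eqP.
Qed.

End CoMaximalSubgroupGraph.

(* Main.v *)
Require Import Defs.
From mathcomp Require Import all_boot all_order all_algebra all_fingroup all_solvable.

Set Implicit Arguments.
Unset Strict Implicit.
Unset Printing Implicit Defensive.

Import GroupScope.

(** A triangle of the co-maximal subgroup graph of [G] is the same thing as
    three proper subgroups with all pairwise products equal to [G]; that they
    are nontrivial and distinct is then automatic ([triangle_freeP]).

    If [G] is nilpotent, its maximal subgroups are normal, so two distinct ones
    have product [G], and three distinct ones form a triangle. A non-cyclic
    group is the union of its maximal subgroups, since every [<[x]>] is proper;
    as a group is never the union of two proper subgroups, there are then at
    least three of them. Hence a nilpotent group with a triangle-free graph is
    cyclic ([nilpotent_triangle_free_cyclic]).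

    If [G] is cyclic, it has exactly one subgroup of each order dividing [#|G|],
    so that [H * K = G] exactly when the indices of [H] and [K] are coprime
    ([cyclic_mulG_coprime_index]). The triangles thus correspond to triples of
    pairwise coprime divisors of [#|G|] other than 1, which exist exactly when
    [#|G|] has at least three prime divisors ([cyclic_triangle_free]). *)

Lemma triangle_freeP (gT : finGroupType) (G : {group gT}) :
  triangle_free (@comax_adj gT G) <->
  (forall H K L : {group gT}, H \proper G -> K \proper G -> L \proper G ->
     H * K = G -> K * L = G -> L * H = G -> False).
Proof.
split=> [tfG H K L pH pK pL HK KL LH | noT c].
  have ntl (A B : {group gT}) : B \proper G -> A * B = G -> A :!=: 1.
    by move=> /properP[_ [x Gx /negP nBx]] AB; apply/eqP=> A1;
      apply: nBx; rewrite -[_ \in B]/(x \in gval B) -(mul1g B) -A1 AB.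
  have vtx (A B : {group gT}) : A \proper G -> B \proper G -> A * B = G ->
      (A :!=: 1) && (A \proper G).
    by move=> pA pB AB; rewrite pA (ntl A B).
  pose h : comax_vertex G := Sub H (vtx H K pH pK HK).
  pose k : comax_vertex G := Sub K (vtx K L pK pL KL).
  pose l : comax_vertex G := Sub L (vtx L H pL pH LH).
  have adj (u v : comax_vertex G) : val u * val v = G -> comax_adj u v.
    move=> uv; rewrite /comax_adj uv eqxx andbT; apply/eqP=> def_v.
    move: uv; rewrite def_v mulGid => vG.
    by case/andP: (valP v) => _; rewrite vG properxx.
  have hk : comax_adj h k by apply: adj.
  have kl : comax_adj k l by apply: adj.
  have lh : comax_adj l h by apply: adj.
  apply: (tfG [:: h; k; l]) => //; rewrite /ucycle /= hk kl lh !inE negb_or.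
  case/andP: hk => -> _; case/andP: kl => -> _; case/andP: lh => + _.
  by rewrite eq_sym => ->.
case: c => [|h [|k [|l [|]]]] //.
rewrite /ucycle /= => /andP[/and4P[hk kl lh _] _] _.
have prp (u : comax_vertex G) : val u \proper G by case/andP: (valP u).
case/andP: hk => _ /eqP hk; case/andP: kl => _ /eqP kl; case/andP: lh => _ /eqP lh.
exact: (noT _ _ _ (prp h) (prp k) (prp l) hk kl lh).
Qed.

Lemma nilpotent_maximal_normal (gT : finGroupType) (G M : {group gT}) :
  nilpotent G -> maximal M G -> M <| G.
Proof.
move=> nilG /maxgroupP[prM maxM]; have sMG := proper_sub prM.
have prN := nilpotent_proper_norm nilG prM.
have [|pNG] := eqVproper (subsetIl G 'N(M)).
  by move/setIidPl=> nMG; rewrite /normal sMG.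
by have defN := maxM ('N_G(M))%G pNG (proper_sub prN); rewrite -{1}defN properxx in prN.
Qed.

Lemma nilpotent_maximal_mulG (gT : finGroupType) (G M N : {group gT}) :
  nilpotent G -> maximal M G -> maximal N G -> M != N -> M * N = G.
Proof.
move=> nilG maxM maxN neqMN.
apply: (mulg_normal_maximal (nilpotent_maximal_normal nilG maxM) maxM).
  exact: proper_sub (maxgroupp maxN).
apply/negP=> sNM; case/eqP: neqMN.
by case/maxgroupP: maxN => _ /(_ M (maxgroupp maxM) sNM)/group_inj.
Qed.

Lemma nilpotent_triangle_free_cyclic (gT : finGroupType) (G : {group gT}) :
  nilpotent G -> triangle_free (@comax_adj gT G) -> cyclic G.
Proof.
move=> nilG /triangle_freeP tfG; apply: contraT => ncG.
have maxG x : x \in G -> exists2 M : {group gT}, maximal M G & x \in M.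
  move=> Gx; have sxG : <[x]> \subset G by rewrite cycle_subG.
  have [defG | [M maxM sxM]] := maximal_exists sxG.
    by rewrite -defG cycle_cyclic in ncG.
  by exists M; rewrite // -cycle_subG.
have prp (M : {group gT}) : maximal M G -> M \proper G by apply: maxgroupp.
have [M1 max1 _] := maxG 1 (group1 G).
have /properP[s1 [x Gx n1x]] := prp _ max1.
have [M2 max2 m2x] := maxG x Gx.
have n12 : M1 != M2 by apply: contraNneq n1x => ->.
have /subsetPn[y m1y n2y] : ~~ (M1 \subset M2).
  apply: contraNN n12 => s12; apply/eqP/esym.
  by case/maxgroupP: max1 => _ /(_ M2 (prp _ max2) s12)/group_inj.
(* Since x is in M2 but not M1, and y in M1 but not M2, x * y is in neither. *)
have [M3 max3 m3xy] := maxG (x * y) (groupM Gx (subsetP s1 y m1y)).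
have n13 : M1 != M3.
  by apply: contraNneq n1x => eq13; move: m3xy; rewrite -eq13 groupMr.
have n23 : M2 != M3.
  by apply: contraNneq n2y => eq23; move: m3xy; rewrite -eq23 groupMl.
case: (tfG M1 M2 M3); rewrite ?prp //; apply: nilpotent_maximal_mulG => //.
by rewrite eq_sym.
Qed.

Lemma cyclic_subgroup_of_index (gT : finGroupType) (G : {group gT}) (d : nat) :
  cyclic G -> d %| #|G| -> exists2 H : {group gT}, H \subset G & #|G : H| = d.
Proof.
move=> /cyclicP[x ->] d_dv.
have dv' : #[x] %/ d %| #[x] by rewrite dvdn_div // divnK.
have /setP/(_ <[x ^+ (#[x] %/ (#[x] %/ d))]>%G) := cycle_sub_group dv'.
rewrite !inE eqxx => /andP[sHx /eqP oH]; exists <[x ^+ (#[x] %/ (#[x] %/ d))]>%G => //.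
by rewrite -divgS // oH divnA // mulKn.
Qed.

Lemma cyclic_mulG_coprime_index (gT : finGroupType) (G H K : {group gT}) :
  cyclic G -> H \subset G -> K \subset G ->
  H * K = G <-> coprime #|G : H| #|G : K|.
Proof.
move=> cG sHG sKG; split=> [HK | ]; last exact: coprime_index_mulG.
rewrite coprime_has_primes ?indexg_gt0 //; apply/hasPn=> p; rewrite !mem_primes.
case/and3P=> pr_p _ pK; apply/negP=> /and3P[_ _ pH].
(* H and K would both lie in the subgroup M of index p. *)
have [M sMG iM] := cyclic_subgroup_of_index cG (dvdn_trans pK (dvdn_indexg G K)).
have subM (A : {group gT}) : A \subset G -> p %| #|G : A| -> A \subset M.
  move=> sAG pA; rewrite -(cardSg_cyclic cG) //.
  rewrite -(@dvdn_pmul2r p) ?prime_gt0 // -{2}iM Lagrange // -(Lagrange sAG).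
  exact: dvdn_mul.
have: G \subset M by rewrite -HK mul_subG ?subM.
by rewrite -indexg_eq1 iM => /eqP p1; rewrite p1 in pr_p.
Qed.

Lemma cyclic_triangle_free (gT : finGroupType) (G : {group gT}) :
  cyclic G ->
  triangle_free (@comax_adj gT G) <-> (size (primes #|G|) <= 2)%N.
Proof.
move=> cG; split=> [/triangle_freeP tfG | le2].
  rewrite leqNgt; apply/negP=> gt2.
  have uG := primes_uniq #|G|.
  have allG p : p \in primes #|G| -> prime p && (p %| #|G|).
    by rewrite mem_primes => /and3P[-> _ ->].
  case: (primes _) gt2 uG allG => [|p [|q [|r s]]] //= _.
  rewrite !inE !negb_or => /and3P[/and3P[npq npr _] /andP[nqr _] _] allG.
  have idx t : t \in [:: p, q, r & s] ->
      exists H : {group gT}, [/\ prime t, H \proper G & #|G : H| = t].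
    case/allG/andP=> pr_t /(cyclic_subgroup_of_index cG)[H sHG iH].
    by exists H; split; rewrite // properE sHG -indexg_eq1 iH neq_ltn prime_gt1 ?orbT.
  have [|H [pr_p pH iH]] := idx p; first by rewrite !inE eqxx.
  have [|K [pr_q pK iK]] := idx q; first by rewrite !inE eqxx ?orbT.
  have [|L [pr_r pL iL]] := idx r; first by rewrite !inE eqxx ?orbT.
  have mulG (A B : {group gT}) : A \proper G -> B \proper G ->
      prime #|G : A| -> prime #|G : B| -> #|G : A| != #|G : B| -> A * B = G.
    move=> pA pB prA prB nAB; apply: coprime_index_mulG; rewrite ?proper_sub //.
    by rewrite prime_coprime // dvdn_prime2.
  by apply: (tfG H K L) => //; apply: mulG; rewrite ?iH ?iK ?iL // eq_sym.
apply/triangle_freeP=> H K L pH pK pL HK KL LH.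
have prm (A : {group gT}) : A \proper G ->
    [/\ A \subset G, prime (pdiv #|G : A|) & pdiv #|G : A| \in primes #|G|].
  rewrite properE -(indexg_eq1 G A) => /andP[sAG iA].
  have pr_d : prime (pdiv #|G : A|) by rewrite pdiv_prime // ltn_neqAle eq_sym iA /=.
  split=> //; rewrite mem_primes pr_d cardG_gt0.
  exact: dvdn_trans (pdiv_dvd _) (dvdn_indexg G A).
have neq (A B : {group gT}) : A \proper G -> B \proper G -> A * B = G ->
    pdiv #|G : A| != pdiv #|G : B|.
  move=> /prm[sA prA _] /prm[sB prB _] /(cyclic_mulG_coprime_index cG sA sB) coAB.
  apply: contraTneq coAB => eqd; apply/negP=> coAB.
  have: coprime (pdiv #|G : A|) (pdiv #|G : A|).
    by apply: coprime_dvdl (pdiv_dvd _) _; rewrite eqd (coprime_dvdr (pdiv_dvd _)).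
  by rewrite prime_coprime // dvdnn.
have := leq_trans (@uniq_leq_size _ [:: pdiv #|G : H|; pdiv #|G : K|; pdiv #|G : L|]
  (primes #|G|) _ _) le2.
rewrite /= ltnn => contra; apply/notF/contra.
  by rewrite !inE negb_or (neq H K) // (neq K L) // eq_sym (neq L H).
by move=> t; rewrite !inE => /or3P[] /eqP->; [case: (prm H)|case: (prm K)|case: (prm L)].
Qed.

Lemma Zp_cyclic (n : nat) : cyclic (Zp n).
Proof.
rewrite /Zp; case: ifP => _; last exact: cyclic1.
by apply/cyclicP; exists Zp1; apply: Zp_cycle.
Qed.

Theorem theorem3p1 (gT : finGroupType) (G : {group gT}) (nilG : nilpotent G) :
  triangle_free (@comax_adj gT G) <->
  (exists p : nat, [/\ prime p, p.-group G & cyclic G]) \/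
  (exists p q a b : nat,
     [/\ prime p, prime q, p <> q, (0 < a)%N /\ (0 < b)%N
       & G \isog Zp (p ^ a * q ^ b)%N]).
Proof.
split=> [tfG | ].
  have cG := nilpotent_triangle_free_cyclic nilG tfG.
  move/(cyclic_triangle_free cG): tfG.
  have oG := prod_prime_decomp (cardG_gt0 G); rewrite prime_decompE big_map in oG.
  have uG := primes_uniq #|G|.
  have allG p : p \in primes #|G| -> prime p && (0 < logn p #|G|)%N.
    by move=> pG; rewrite logn_gt0 pG andbT; move: pG; rewrite mem_primes => /andP[].
  case: (primes #|G|) oG uG allG => [|p [|q []]] //= oG uG allG _.
  - (* The trivial group is a p-group for every p, here p = 2. *)
    left; exists 2; split=> //; rewrite big_nil in oG.
    by rewrite /pgroup oG.
  - left; exists p; have /andP[pr_p _] := allG p (mem_head _ _).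
    by split; rewrite // /pgroup oG big_seq1 pnatX pnat_id.
  - right; exists p, q, (logn p #|G|), (logn q #|G|).
    have /andP[pr_p a0] := allG p (mem_head _ _).
    have /allG/andP[pr_q b0] : q \in [:: p; q] by rewrite !inE eqxx orbT.
    split=> //; first by apply/eqP; move: uG; rewrite inE andbT.
    rewrite big_cons big_seq1 /= in oG; rewrite -oG isog_cyclic_card //.
    by rewrite card_Zp ?cardG_gt0 // eqxx andbT; apply: Zp_cyclic.
have le2 p q n (s := [:: p; q]) : {subset primes n <= s} -> (size (primes n) <= 2)%N.
  exact: uniq_leq_size (primes_uniq n).
case=> [[p [pr_p pG cG]] | [p [q [a [b [pr_p pr_q npq [a0 b0] isoG]]]]]].
  apply/(cyclic_triangle_free cG)/(le2 p p)=> r; rewrite mem_primes => /and3P[pr_r _ rG].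
  by rewrite !inE; move/pgroupP: pG => /(_ r pr_r rG); rewrite inE => ->.
have cG : cyclic G.
  by rewrite (isog_cyclic isoG); apply: Zp_cyclic.
have n0 : (0 < p ^ a * q ^ b)%N by rewrite muln_gt0 !expn_gt0 !prime_gt0.
apply/(cyclic_triangle_free cG); rewrite (card_isog isoG) card_Zp //.
apply: (le2 p q) => r; rewrite primesM ?expn_gt0 ?prime_gt0 //.
by rewrite !primesX // !primes_prime // !inE.
Qed.
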